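(* Let $V\subseteq\mathbb{C}^n$ be an affine variety such that the projective closure $\overline{V}$ of $V$ has dimension $d$ and degree $k$. Suppose also that the ideal $I(V)\subseteq\mathbb{C}[x_1,\ldots,x_n]$ of $V$ is generated by polynomials over $\mathbb{R}$. Let $\mathcal{A}\subseteq V\cap\mathbb{R}^n$ be an $s$-distance set. Then $$|\mathcal{A}|\leq\frac{k\cdot s^d}{d!}+O(s^{d-1}),$$ where the asymptotics is in $s\to\infty$ and the implied constant depends only on $V$ (and not on $s$ or $\mathcal{A}$).
   Context: For $\mathcal{A}\subseteq\mathbb{R}^n$, let $d(\mathcal{A})=\{d(p_1,p_2): p_1,p_2\in\mathcal{A},\ p_1\neq p_2\}$ be the set of non-zero Euclidean distances among points of $\mathcal{A}$. The set $\mathcal{A}$ is an $s$-distance set if $|d(\mathcal{A})|\le s$. An affine variety is the common zero set in $\mathbb{C}^n$ of a set of polynomials (not necessarily irreducible), and $I(V)$ is the ideal of all polynomials in $\mathbb{C}[x_1,\ldots,x_n]$ vanishing on $V$. The projective closure $\overline{V}$ is the Zariski closure of $V$ in $\mathbb{P}^n(\mathbb{C})$ under the standard embedding $\mathbb{C}^n\subset\mathbb{P}^n(\mathbb{C})$; its degree is the usual degree of a projective variety, i.e. $d!$ times the leading coefficient of its Hilbert polynomial. *)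

(* Defs.v *)
From HB Require Import structures.
From mathcomp Require Import all_boot all_order all_algebra.
From mathcomp Require Import boolp classical_sets functions cardinality reals.
From mathcomp Require Import complex.
From mathcomp Require Import mpoly.

Set Implicit Arguments.
Unset Strict Implicit.
Unset Printing Implicit Defensive.

Import Order.TTheory GRing.Theory Num.Theory.

Local Open Scope classical_set_scope.
Local Open Scope ring_scope.

Section Affine.
Variables (K : fieldType) (n : nat).
Implicit Types (V : set 'rV[K]_n) (S : set {mpoly K[n]}).

Definition zero_locus S : set 'rV[K]_n :=
  [set x | forall p, S p -> p.@[x 0] = 0].

Definition affine_variety V := exists S, V = zero_locus S.

Definition vanishing_ideal V : set {mpoly K[n]} :=
  [set p | forall x, V x -> p.@[x 0] = 0].

Definition ideal_gen S : set {mpoly K[n]} :=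
  [set p | exists (m : nat) (c g : 'I_m -> {mpoly K[n]}),
     (forall i, S (g i)) /\ p = \sum_(i < m) c i * g i].

End Affine.

Definition ideal_defined_over_reals (R : realType) (n : nat)
    (V : set 'rV[R[i]]_n) :=
  exists S : set {mpoly R[n]},
    vanishing_ideal V = ideal_gen (map_mpoly (real_complex R) @` S).

Section Projective.
Variables (K : fieldType) (n : nat).

(* P^n(K) as the set of lines through the origin of K^(n+1). *)
Definition proj_space := {L : {vspace 'rV[K]_n.+1} | \dim L == 1%N}.

Implicit Types (X W : set proj_space) (p : {mpoly K[n.+1]}).

Definition vanishes_at p (L : proj_space) :=
  forall v : 'rV[K]_n.+1, v \in sval L -> p.@[v 0] = 0.

Definition zariski_closed X :=
  exists S : set {mpoly K[n.+1]},
    (forall p, S p -> exists m : nat, p \is m.-homog) /\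
    X = [set L | forall p, S p -> vanishes_at p L].

Definition zariski_closure W : set proj_space :=
  \bigcap_(X in [set X | zariski_closed X /\ W `<=` X]) X.

Lemma affine_line_subproof (x : 'rV[K]_n) :
  \dim <[row_mx (1 : 'rV[K]_1) x : 'rV[K]_n.+1]>%VS == 1%N.
Proof.
rewrite dim_vline eqb1; apply/eqP => h.
have := congr1 (fun A : 'M_(1, 1 + n) => lsubmx A 0 0) h.
by rewrite /= row_mxKl !mxE => /eqP; rewrite oner_eq0.
Qed.

(* The standard embedding x |-> [1 : x_1 : ... : x_n]. *)
Definition affine_embedding (x : 'rV[K]_n) : proj_space :=
  exist (fun L => is_true (\dim L == 1%N)) _ (affine_line_subproof x).

Definition proj_closure (V : set 'rV[K]_n) : set proj_space :=
  zariski_closure (affine_embedding @` V).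

(* The degree m part of the homogeneous ideal of X, inside the space of
   homogeneous polynomials of degree m; homog_idealP shows that the default
   value of xget is never used. *)
Definition homog_ideal X (m : nat) : {vspace dhomog n.+1 K m} :=
  xget 0%VS [set U : {vspace dhomog n.+1 K m} |
    forall q, q \in U <-> forall L, X L -> vanishes_at (val q) L].

Lemma homog_idealP X (m : nat) (q : dhomog n.+1 K m) :
  q \in homog_ideal X m <-> forall L, X L -> vanishes_at (val q) L.
Proof.
pose Z := fun r : dhomog n.+1 K m => forall L, X L -> vanishes_at (val r) L.
pose sub (U : {vspace dhomog n.+1 K m}) := forall q1, q1 \in U -> Z q1.
have ZD q1 q2 : Z q1 -> Z q2 -> Z (q1 + q2).
  by move=> Z1 Z2 L XL v vL; rewrite (raddfD (@mpoly_of_dhomog _ _ _)) mevalD (Z1 L) ?(Z2 L) ?addr0.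
have ZZ c q1 : Z q1 -> Z (c *: q1).
  by move=> Zq L XL v vL; rewrite [val _](linearZ_LR (@mpoly_of_dhomog _ _ _)) mevalZ (Zq L) ?mulr0.
have sub0 : sub 0%VS.
  by move=> q1; rewrite memv0 => /eqP-> L XL v vL; rewrite (raddf0 (@mpoly_of_dhomog _ _ _)) meval0.
suff [U hU] : exists U : {vspace dhomog n.+1 K m}, forall q1, q1 \in U <-> Z q1.
  by rewrite /homog_ideal; case: xgetP => [V -> //|/(_ U)]; case.
suff [U [sU maxU]] : exists U, sub U /\
    forall W : {vspace dhomog n.+1 K m}, sub W -> (\dim W <= \dim U)%N.
  exists U => q1; split=> [/sU //|Zq].
  have sW : sub (U + <[q1]>)%VS.
    move=> _ /memv_addP[u uU [_ /vlineP[c ->] ->]].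
    by apply: ZD; [exact: sU | exact: ZZ].
  have := maxU _ sW; rewrite (geq_leqif (dimv_leqif_sup (addvSl _ _))).
  by rewrite subv_add -memvE => /andP[].
pose P k := `[< exists U, sub U /\ \dim U = k >].
have exP : exists k, P k.
  by exists (\dim (0%VS : {vspace dhomog n.+1 K m})); apply/asboolP; exists 0%VS.
have ubP k : P k -> (k <= \dim {:dhomog n.+1 K m})%N.
  by move=> /asboolP[U [_ <-]]; apply: dimvS; exact: subvf.
case: (ex_maxnP exP ubP) => k /asboolP[U [sU dU]] maxk.
by exists U; split=> // W sW; rewrite dU; apply: maxk; apply/asboolP; exists W.
Qed.

Definition hilbert_function X (m : nat) : nat :=
  (\dim {: dhomog n.+1 K m} - \dim (homog_ideal X m))%N.

Definition is_hilbert_polynomial X (P : {poly rat}) :=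
  exists m0 : nat, forall m : nat, (m0 <= m)%N ->
    P.[m%:R] = (hilbert_function X m)%:R.

(* The dimension of a projective variety is the degree of its Hilbert polynomial
   (Cox, Little and O'Shea, Ideals, Varieties, and Algorithms, section 9.3).
   The empty variety, whose Hilbert polynomial is 0, has no dimension here. *)
Definition has_proj_dim X (d : nat) :=
  exists P, is_hilbert_polynomial X P /\ size P = d.+1.

Definition has_proj_degree X (k : nat) :=
  exists P, is_hilbert_polynomial X P /\
    k%:R = ((size P).-1)`!%:R * lead_coef P.

End Projective.

Section Distances.
Variables (R : realType) (n : nat).

Definition edist (p q : 'rV[R]_n) : R :=
  Num.sqrt (\sum_(i < n) (p 0 i - q 0 i) ^+ 2).

Definition distances (A : set 'rV[R]_n) : set R :=
  [set t | exists p q, [/\ A p, A q, p != q & t = edist p q]].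

Definition distance_set (s : nat) (A : set 'rV[R]_n) :=
  (distances A #<= `I_s)%card.

Definition real_points (V : set 'rV[R[i]]_n) : set 'rV[R]_n :=
  [set x | V (map_mx (real_complex R) x)].

End Distances.

(* Main.v *)
Require Import Defs.
From HB Require Import structures.
From mathcomp Require Import all_boot all_order all_algebra.
From mathcomp Require Import boolp classical_sets functions cardinality reals.
From mathcomp Require Import complex.
From mathcomp Require Import mpoly.

(* Let h be the Hilbert function of the projective closure of V. If points
   a_1, ..., a_N of A satisfy N > h(s), then some nonzero vector w satisfies
   sum_i w_i m(a_i) = 0 for all monomials m of degree at most s, since the
   evaluation at the a_i of the forms of degree s has rank at most h(s). The
   a_i being real, one may take w real. The polynomial
   F(x, y) = prod_t (t^2 - |x - y|^2), over the distances t of A, has degree at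
   most 2s, so that sum_ij w_i w_j F(a_i, a_j) = 0; but F(a_i, a_j) = 0 for
   i <> j and F(a_i, a_i) is a positive constant, so w = 0, a contradiction.
   Hence |A| <= h(s), which is the Hilbert polynomial at s for large s. *)

Set Implicit Arguments.
Unset Strict Implicit.
Unset Printing Implicit Defensive.

Import Order.TTheory GRing.Theory Num.Theory.

Local Open Scope classical_set_scope.
Local Open Scope ring_scope.

(** * Degrees of products and quadratic forms in two groups of variables *)

Lemma msizeM_leS (K : idomainType) n (p q : {mpoly K[n]}) i j :
  (msize p <= i.+1)%N -> (msize q <= j.+1)%N -> (msize (p * q) <= (i + j).+1)%N.
Proof.
move=> lep leq; have [->|p0] := eqVneq p 0; first by rewrite mul0r mmeasure0.
have [->|q0] := eqVneq q 0; first by rewrite mulr0 mmeasure0.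
have := leq_add lep leq; rewrite msizeM // addSn addnS.
by case: (msize p + msize q)%N.
Qed.

(* A monomial of degree at most 2s in (x, y) has degree at most s in x or in y,
   so the quadratic form of a polynomial F of degree at most 2s vanishes at
   every u that annihilates the polynomials of degree at most s. *)
Lemma quad_form_annihilated (K : comNzRingType) (n N s : nat)
    (a : 'I_N -> 'rV[K]_n) (u : 'I_N -> K) (F : {mpoly K[n + n]}) :
  (msize F <= (2 * s).+1)%N ->
  (forall e : 'I_n -> nat, (\sum_k e k <= s)%N ->
     \sum_i u i * \prod_k a i 0 k ^+ e k = 0) ->
  \sum_i \sum_j u i * u j * F.@[row_mx (a i) (a j) 0] = 0.
Proof.
move=> degF annu.
pose mon (e : 'I_n -> nat) := \sum_i u i * \prod_k a i 0 k ^+ e k.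
transitivity (\sum_(m <- msupp F) F@_m *
   (mon (fun k => m (lshift n k)) * mon (fun k => m (rshift n k)))).
  under eq_bigr => i _ do under eq_bigr => j _ do rewrite mevalE mulr_sumr.
  under eq_bigr => i _ do rewrite exchange_big.
  rewrite exchange_big; apply: eq_bigr => m _ /=.
  rewrite /mon mulr_suml mulr_sumr; apply: eq_bigr => i _.
  rewrite !mulr_sumr; apply: eq_bigr => j _.
  rewrite big_split_ord /=.
  under eq_bigr => k _ do rewrite row_mxEl.
  under [X in _ * (_ * (_ * X))]eq_bigr => k _ do rewrite row_mxEr.
  by rewrite [LHS]mulrCA; congr (_ * _); rewrite mulrACA.
rewrite big_seq big1 // => m mF.
have := leq_trans (msize_mdeg_lt mF) degF.
rewrite ltnS mdegE big_split_ord /= => le2s.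
case: (leqP (\sum_k m (lshift n k)) s) => [|lts].
  by move/annu => m0; rewrite {1}/mon m0 mul0r mulr0.
rewrite /mon [X in _ * (_ * X)]annu ?mulr0 //.
move: le2s; rewrite mul2n -addnn; apply: contraTT; rewrite -!ltnNge => lt2.
by apply: leq_trans (leq_add lts lt2); rewrite addSn addnS ltnS leqnSn.
Qed.

(** * The polynomial built from the distances *)

Section FewDistances.
Variables (R : realType) (n : nat).
Implicit Types (x y : 'rV[R]_n) (ts : seq R).

(** Squaring the distance makes the factor a polynomial in both points, of degree at most 2. As
    [msize] is one more than the degree, the bounds below read 3 and [(2 * size ts).+1]. *)
Definition dist_factor (t : R) : {mpoly R[n + n]} :=
  (t ^+ 2)%:MP - \sum_(k < n) ('X_(lshift n k) - 'X_(rshift n k)) ^+ 2.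

Definition dist_poly ts : {mpoly R[n + n]} := \prod_(t <- ts) dist_factor t.

Lemma msize_dist_factor t : (msize (dist_factor t) <= 3)%N.
Proof.
apply: leq_trans (mmeasureD_le _ _ _) _; rewrite geq_max mmeasureC.
rewrite (leq_trans (leq_b1 _)) //= mmeasureN.
apply: leq_trans (mmeasure_sum _ _ _ _) _; apply/bigmax_leqP => k _.
have le2 : (msize ('X_(lshift n k) - 'X_(rshift n k) : {mpoly R[n + n]}) <= 2)%N.
  by apply: leq_trans (mmeasureD_le _ _ _) _; rewrite mmeasureN !msizeX !mdeg1.
by rewrite expr2; exact: (msizeM_leS le2 le2).
Qed.

Lemma msize_dist_poly ts : (msize (dist_poly ts) <= (2 * size ts).+1)%N.
Proof.
rewrite /dist_poly; elim: ts => [|t ts IH]; first by rewrite big_nil msize1.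
by rewrite big_cons mulnS; apply: msizeM_leS; [exact: msize_dist_factor | exact: IH].
Qed.

Lemma meval_dist_factor t x y :
  (dist_factor t).@[row_mx x y 0] = t ^+ 2 - edist x y ^+ 2.
Proof.
rewrite /edist sqr_sqrtr; last by apply: sumr_ge0 => k _; exact: sqr_ge0.
rewrite mevalB mevalC (raddf_sum (meval _)); congr (_ - _); apply: eq_bigr => k _.
by rewrite /= rmorphXn /= mevalB !mevalXU row_mxEl row_mxEr.
Qed.

Lemma edist_eq0 x y : edist x y = 0 -> x = y.
Proof.
have ge0 (k : 'I_n) : true -> 0 <= (x 0 k - y 0 k) ^+ 2 by rewrite sqr_ge0.
move/eqP; rewrite sqrtr_eq0 le_eqVlt ltNge sumr_ge0 // orbF psumr_eq0 //.
move/allP => h; apply/rowP => k; apply/eqP.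
by have := h k (mem_index_enum _); rewrite sqrf_eq0 subr_eq0.
Qed.

Lemma edistxx x : edist x x = 0.
Proof. by rewrite /edist big1 ?sqrtr0 // => k _; rewrite subrr expr0n. Qed.

Lemma meval_dist_poly_diag ts x : 0 \notin ts ->
  (dist_poly ts).@[row_mx x x 0] = \prod_(t <- ts) t ^+ 2 /\
  \prod_(t <- ts) t ^+ 2 != 0.
Proof.
move=> ts0; rewrite /dist_poly rmorph_prod; split.
  by apply: eq_bigr => t _; rewrite /= meval_dist_factor edistxx expr0n subr0.
rewrite prodf_seq_neq0; apply/allP => t tts /=; rewrite sqrf_eq0.
by apply: contraNneq ts0 => <-.
Qed.

Lemma meval_dist_poly_off ts x y : edist x y \in ts ->
  (dist_poly ts).@[row_mx x y 0] = 0.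
Proof.
move=> xy; rewrite /dist_poly rmorph_prod.
apply/eqP; rewrite prodf_seq_eq0; apply/hasP; exists (edist x y) => //.
by rewrite /= meval_dist_factor subrr.
Qed.

(** The values of [dist_poly ts] at the pairs of points form a nonzero multiple of the identity
    matrix, so the vanishing quadratic form is a multiple of a sum of real squares. *)
Lemma few_distances_annihilator (N s : nat) (a : 'I_N -> 'rV[R]_n)
    (u : 'I_N -> R) (ts : seq R) :
  (size ts <= s)%N -> 0 \notin ts ->
  (forall i j, i != j -> edist (a i) (a j) \in ts) ->
  (forall e : 'I_n -> nat, (\sum_k e k <= s)%N ->
     \sum_i u i * \prod_k a i 0 k ^+ e k = 0) ->
  forall i, u i = 0.
Proof.
move=> szts ts0 ats annu.
have degF : (msize (dist_poly ts) <= (2 * s).+1)%N.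
  by apply: leq_trans (msize_dist_poly ts) _; rewrite ltnS leq_mul2l.
have := quad_form_annihilated degF annu.
set c := \prod_(t <- ts) t ^+ 2.
have -> : \sum_i \sum_j u i * u j * (dist_poly ts).@[row_mx (a i) (a j) 0]
    = c * \sum_i u i ^+ 2.
  rewrite mulr_sumr; apply: eq_bigr => i _; rewrite (bigD1 i) //= big1.
    have [-> _] := meval_dist_poly_diag (a i) ts0.
    by rewrite addr0 mulrC expr2.
  by move=> j; rewrite eq_sym => /ats/meval_dist_poly_off ->; rewrite mulr0.
(* The constant [c] does not depend on the point, so the origin serves as well as any. *)
have [_ c0] := meval_dist_poly_diag 0 ts0.
move/eqP; rewrite mulf_eq0 (negPf c0) /= psumr_eq0; last by move=> i _; exact: sqr_ge0.
move=> /allP h i; apply/eqP.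
by have := h i (mem_index_enum _); rewrite sqrf_eq0.
Qed.

End FewDistances.

(** * Evaluation of forms at affine points *)

Section Evaluation.
Variables (K : fieldType) (n : nat).

Lemma affine_embedding_closure (V : set 'rV[K]_n) x :
  V x -> proj_closure V (affine_embedding x).
Proof. by move=> Vx X [_]; apply; exists x. Qed.

Definition eval_points (m N : nat) (b : 'I_N -> 'rV[K]_n) (q : dhomog n.+1 K m)
  : 'rV[K]_N := \row_i (val q).@[(row_mx (1 : 'rV[K]_1) (b i) : 'rV[K]_n.+1) 0].

Lemma eval_points_is_linear m N b : linear (@eval_points m N b).
Proof. by move=> c p q; apply/rowP => i; rewrite !mxE -mevalZ -mevalD. Qed.

HB.instance Definition _ m N b := GRing.isLinear.Build K _ _ _
  (@eval_points m N b) (@eval_points_is_linear m N b).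

(** Forms vanishing on the projective closure lie in the kernel of the evaluation map, so
    rank-nullity bounds its rank by the codimension of these forms. *)
Lemma dim_eval_points (V : set 'rV[K]_n) m N (b : 'I_N -> 'rV[K]_n) :
  (forall i, V (b i)) ->
  (\dim (limg (linfun (@eval_points m N b))) <= hilbert_function (proj_closure V) m)%N.
Proof.
move=> Vb; rewrite -[X in (X <= _)%N](addKn (\dim (lker (linfun (@eval_points m N b))))).
have := limg_ker_dim (linfun (@eval_points m N b)) fullv; rewrite capfv => ->.
apply/leq_sub2l/dimvS/subvP => q /homog_idealP q0.
rewrite memv_ker lfunE; apply/eqP/rowP => i; rewrite !mxE.
exact: (q0 _ (affine_embedding_closure (Vb i)) _ (memv_line _)).
Qed.

Lemma low_rank_annihilator N (U : {vspace 'rV[K]_N}) : (\dim U < N)%N ->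
  exists2 w : 'rV[K]_N, w != 0 & forall v, v \in U -> \sum_i w 0 i * v 0 i = 0.
Proof.
move=> ltU; pose B := \matrix_(l < \dim U) (vbasis U)`_l.
(* [B^T] has [N] rows and fewer columns, hence a nontrivial left kernel. *)
have ker0 : kermx B^T != 0.
  by rewrite kermx_eq0 -row_leq_rank -ltnNge (leq_ltn_trans _ ltU) // rank_leq_col.
exists (nz_row (kermx B^T)); first by rewrite nz_row_eq0.
set w := nz_row _; have wB : w *m B^T = 0 by apply/sub_kermxP/nz_row_sub.
move=> v /coord_vbasis ->.
under eq_bigr => i _ do rewrite summxE mulr_sumr.
rewrite exchange_big big1 //= => l _.
have := congr1 (fun M : 'rV_(\dim U) => M 0 l) wB; rewrite !mxE => wBl.
transitivity (coord (vbasis U) l v * \sum_j w 0 j * B^T j l); last by rewrite wBl mulr0.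
by rewrite mulr_sumr; apply: eq_bigr => i _; rewrite !mxE mulrCA.
Qed.

End Evaluation.

(** * Bounding the number of points by the Hilbert function *)

Section HilbertBound.
Variables (R : realType) (n : nat).

(** Variable [ord0] is the homogenizing one, which takes the value 1 on embedded points. The
    subtraction is truncated, so the total degree is [s] only when the exponents sum to at most
    [s]. *)
Definition homogenized_exponent (s : nat) (e : 'I_n -> nat) : 'X_{1..n.+1} :=
  [multinom if unlift ord0 i is Some k then e k else (s - \sum_k e k)%N | i < n.+1].

Lemma homogenized_monomial_dhomog (K : fieldType) s (e : 'I_n -> nat) :
  (\sum_k e k <= s)%N ->
  ('X_[homogenized_exponent s e] : {mpoly K[n.+1]}) \is s.-homog.
Proof.
move=> les; rewrite dhomogX; apply/eqP.
rewrite [LHS]mdegE /homogenized_exponent big_ord_recl mnmE unlift_none.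
rewrite [X in (_ + X)%N](_ : _ = \sum_k e k)%N ?subnK //.
by apply: eq_bigr => k _; rewrite mnmE liftK.
Qed.

Lemma eval_homogenized_monomial (K : fieldType) s (e : 'I_n -> nat) (x : 'rV[K]_n) :
  ('X_[homogenized_exponent s e]).@[(row_mx (1 : 'rV[K]_1) x : 'rV[K]_n.+1) 0]
    = \prod_k x 0 k ^+ e k.
Proof.
rewrite mevalX big_ord_recl /homogenized_exponent.
have -> : (row_mx (1 : 'rV[K]_1) x : 'rV[K]_n.+1) 0 ord0 = 1.
  have <- : row_mx (1 : 'rV[K]_1) x 0 (lshift n ord0) = 1 by rewrite row_mxEl mxE.
  by congr (row_mx _ _ _ _); apply: val_inj.
rewrite expr1n mul1r; apply: eq_bigr => k _; rewrite mnmE liftK; congr (_ ^+ _).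
by rewrite -(row_mxEr (1 : 'rV[K]_1) x 0 k); congr (row_mx _ _ _ _); apply: val_inj.
Qed.

Lemma ReM_real (z : R[i]) (x : R) : complex.Re (z * x%:C%C) = complex.Re z * x.
Proof. by case: z => a b /=; rewrite mulr0 subr0. Qed.

Lemma ImM_real (z : R[i]) (x : R) : complex.Im (z * x%:C%C) = complex.Im z * x.
Proof. by case: z => a b /=; rewrite mulr0 add0r. Qed.

Lemma few_distances_hilbert_bound (V : set 'rV[R[i]]_n) (s N : nat)
    (a : 'I_N -> 'rV[R]_n) (ts : seq R) :
  (forall i, real_points V (a i)) -> (size ts <= s)%N -> 0 \notin ts ->
  (forall i j, i != j -> edist (a i) (a j) \in ts) ->
  (N <= hilbert_function (proj_closure V) s)%N.
Proof.
move=> Va szts ts0 ats; rewrite leqNgt; apply/negP => ltN.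
pose b i := map_mx (real_complex R) (a i).
have [w w0 annw] := low_rank_annihilator
  (leq_ltn_trans (@dim_eval_points _ _ V s N b Va) ltN).
have annC (e : 'I_n -> nat) : (\sum_k e k <= s)%N ->
    \sum_i w 0 i * (\prod_k a i 0 k ^+ e k)%:C%C = 0.
  move=> les; pose q := DHomog (homogenized_monomial_dhomog R[i] les).
  rewrite -[RHS](annw (eval_points b q)); last by rewrite -lfunE memv_img ?memvf.
  apply: eq_bigr => i _; rewrite mxE eval_homogenized_monomial rmorph_prod.
  by congr (_ * _); apply: eq_bigr => k _; rewrite mxE rmorphXn.
(* The monomials take real values at the [a i], so the real and imaginary parts of [w] satisfy the
   same relations separately. *)
have Re0 i : complex.Re (w 0 i) = 0.
  apply: (few_distances_annihilator (u := fun i => complex.Re (w 0 i)) szts ts0 ats) => e.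
  by move=> /annC/(congr1 (@complex.Re R)); rewrite raddf_sum; under eq_bigr do rewrite /= ReM_real.
have Im0 i : complex.Im (w 0 i) = 0.
  apply: (few_distances_annihilator (u := fun i => complex.Im (w 0 i)) szts ts0 ats) => e.
  by move=> /annC/(congr1 (@complex.Im R)); rewrite raddf_sum; under eq_bigr do rewrite /= ImM_real.
move/negP: w0; apply; apply/eqP/rowP => i; rewrite mxE.
by apply/eqP; rewrite eq_complex Re0 Im0 !eqxx.
Qed.

Lemma uniq_distance_set_bound (V : set 'rV[R[i]]_n) (s : nat) (A : set 'rV[R]_n)
    (r : seq 'rV[R]_n) :
  A `<=` real_points V -> distance_set s A -> uniq r -> {in r, forall x, A x} ->
  (size r <= hilbert_function (proj_closure V) s)%N.
Proof.
move=> AV sA ur rA.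
have finD : finite_set (distances A) by apply/finite_set_leP; exists s.
apply: (@few_distances_hilbert_bound V s (size r) (fun i => r`_i)
  (finmap.enum_fset (fset_set (distances A)))).
- by move=> i; apply/AV/rA/mem_nth.
- exact: geq_card_fset_set.
(* Distances are taken between distinct points only, so 0 is not among them. *)
- rewrite in_fset_set // notin_setE => -[p [q [_ _ /eqP + /esym/edist_eq0]]].
  by [].
- move=> i j ij; rewrite in_fset_set // inE; exists r`_i, r`_j; split => //.
  + exact/rA/mem_nth.
  + exact/rA/mem_nth.
  + by rewrite nth_uniq.
Qed.

Lemma distance_set_card (V : set 'rV[R[i]]_n) (s : nat) (A : set 'rV[R]_n) :
  A `<=` real_points V -> distance_set s A ->
  exists2 N, (A #= `I_N)%card & (N <= hilbert_function (proj_closure V) s)%N.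
Proof.
move=> AV sA; have bound := uniq_distance_set_bound AV sA.
have [finA|infA] := pselect (finite_set A).
  have /finite_setP[N AN] := finA; exists N => //.
  rewrite -(card_fset_set AN) bound ?finmap.fset_uniq // => x.
  by rewrite in_fset_set // inE.
(* An infinite [A] would contain one point more than the bound for finite subsets allows. *)
have [B BA] := infinite_set_fset (hilbert_function (proj_closure V) s).+1 infA.
by rewrite ltnNge bound ?finmap.fset_uniq // => x xB; apply: BA.
Qed.

End HilbertBound.

(** * From the Hilbert function to the asymptotic bound *)

Lemma hilbert_polynomial_unique (K : fieldType) n (X : set (proj_space K n)) P Q :
  is_hilbert_polynomial X P -> is_hilbert_polynomial X Q -> P = Q.
Proof.
move=> [m0 hP] [m1 hQ]; apply/eqP; rewrite -subr_eq0; apply/negPn/negP => PQ0.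
(* These are [size (P - Q)] distinct roots of [P - Q], one more than its degree. *)
pose rs := [seq (maxn m0 m1 + i)%:R : rat | i <- iota 0 (size (P - Q))].
have := max_poly_roots (rs := rs) PQ0; rewrite size_map size_iota ltnn.
rewrite map_inj_uniq ?iota_uniq; last first.
  by move=> i j /eqP; rewrite eqr_nat eqn_add2l => /eqP.
suff -> : all (root (P - Q)) rs by move=> /(_ isT isT).
apply/allP => _ /mapP[i _ ->]; rewrite rootE hornerD hornerN hP ?hQ ?subrr //.
  by rewrite (leq_trans (leq_maxr m0 m1)) ?leq_addr.
by rewrite (leq_trans (leq_maxl m0 m1)) ?leq_addr.
Qed.

Lemma poly_le_lead_term (R : realFieldType) (P : {poly R}) d : size P = d.+1 ->
  exists c : R, forall s : nat, (0 < s)%N ->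
    P.[s%:R] <= lead_coef P * s%:R ^+ d + c * s%:R ^ (d%:Z - 1).
Proof.
move=> szP; exists (\sum_(i < d) `|P`_i|) => s s0.
rewrite horner_coef szP big_ord_recr /= lead_coefE szP addrC lerD2l.
rewrite mulr_suml; apply: ler_sum => i _.
apply: le_trans (ler_norm _) _; rewrite normrM ler_wpM2l //.
(* For [d = 0] there is no lower term to estimate; otherwise the exponent [d - 1] is a natural
   number. *)
case: d szP i => [|d] _ i; first by case: i.
have -> : d.+1%:Z - 1 = d%:Z by rewrite -addn1 PoszD addrK.
rewrite ger0_norm ?exprn_ge0 ?ler0n //.
by rewrite ler_weXn2l ?ler1n // -ltnS.
Qed.

(* The exponent d - 1 is an integer, so that it is -1 when d = 0. *)
Theorem corollary1p9 (R : realType) (n d k : nat) (V : set 'rV[R[i]]_n) :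
  affine_variety V ->
  has_proj_dim (proj_closure V) d ->
  has_proj_degree (proj_closure V) k ->
  ideal_defined_over_reals V ->
  exists (c : R) (s0 : nat), forall (s : nat) (A : set 'rV[R]_n),
    (s0 <= s)%N ->
    A `<=` real_points V ->
    distance_set s A ->
    exists N : nat, (A #= `I_N)%card /\
      N%:R <= k%:R * s%:R ^+ d / d`!%:R + c * s%:R ^ (d%:Z - 1).
Proof.
move=> _ [P [hP szP]] [Q [hQ kQ]] _.
(* Dimension and degree each come with their own Hilbert polynomial; uniqueness identifies the
   two. *)
rewrite -(hilbert_polynomial_unique hP hQ) szP /= in kQ.
have szPR : size (map_poly (@ratr R) P) = d.+1 by rewrite size_map_poly.
have [c leP] := poly_le_lead_term szPR.
have [m0 hm0] := hP.
(* Beyond [m0] the Hilbert polynomial gives the Hilbert function; [s] at least 1 is what lets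
   [s ^ (d - 1)] dominate the lower powers. *)
exists c, (maxn m0 1) => s A; rewrite geq_max => /andP[m0s s0] AV sA.
have [N AN leN] := distance_set_card AV sA.
exists N; split=> //; apply: (@le_trans _ _ (map_poly (@ratr R) P).[s%:R]).
  by rewrite -(ratr_nat R s) horner_map hm0 //= ratr_nat ler_nat.
apply: le_trans (leP _ s0) _; rewrite lerD2r lead_coef_map.
have -> : lead_coef P = k%:R / d`!%:R.
  by rewrite kQ mulrC mulKf // pnatr_eq0 -lt0n fact_gt0.
by rewrite fmorph_div /= !ratr_nat mulrAC.
Qed.
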